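(* Let $n\geq 3$ and let $G=(V,E)$ be a forest with $n$ vertices, with a fixed partition $E=E_{\mathrm{refl}}\sqcup E_{\mathrm{refr}}$ of its edge set into reflection edges and refraction edges. Let $(\sigma,i,\epsilon)\in\Xi_G$, and let $T=(V_T,E_T)$ be the connected component of $G$ containing the vertex $\sigma^{-1}\!\left(i+\tfrac{1}{2}(1-\epsilon)\right)$. Then the orbit of $\Theta$ containing $(\sigma,i,\epsilon)$ has size \[\frac{|V_T|\,n(n-1)}{\gcd\!\left(n,\chi(T;E_{\mathrm{refl}},E_{\mathrm{refr}})\right)}.\]
   Context: For $i\in\mathbb{Z}/n\mathbb{Z}$, $s_i$ denotes the transposition of $\mathbb{Z}/n\mathbb{Z}$ swapping $i$ and $i+1$ (so $s_n$ swaps $n$ and $1$). A labeling of a graph $G=(V,E)$ with $n$ vertices is a bijection $V\to\mathbb{Z}/n\mathbb{Z}$; $\Lambda_G$ is the set of labelings. Given a partition $E=E_{\mathrm{refl}}\sqcup E_{\mathrm{refr}}$, let $\Xi_G=\Lambda_G\times\mathbb{Z}/n\mathbb{Z}\times\{\pm1\}$ and define $\Theta\colon\Xi_G\to\Xi_G$ by $\Theta(\sigma,i,\epsilon)=(s_i\circ\sigma,i+\epsilon,\epsilon)$ if $\{\sigma^{-1}(i),\sigma^{-1}(i+1)\}\notin E$; $\Theta(\sigma,i,\epsilon)=(\sigma,i+\epsilon,\epsilon)$ if $\{\sigma^{-1}(i),\sigma^{-1}(i+1)\}\in E_{\mathrm{refl}}$; and $\Theta(\sigma,i,\epsilon)=(s_i\circ\sigma,i-\epsilon,-\epsilon)$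 if $\{\sigma^{-1}(i),\sigma^{-1}(i+1)\}\in E_{\mathrm{refr}}$. ($\Theta$ is a bijection.) Here $i+\tfrac12(1-\epsilon)$ means $i$ if $\epsilon=1$ and $i+1$ if $\epsilon=-1$. For a tree component $T=(V_T,E_T)$ of a forest $G$, there is a partition $V_T=X_1\sqcup X_{-1}$, unique up to swapping the two parts, such that every edge of $E_{\mathrm{refr}}\cap E_T$ has one endpoint in each part and every edge of $E_{\mathrm{refl}}\cap E_T$ has both endpoints in the same part; define $\chi(T;E_{\mathrm{refl}},E_{\mathrm{refr}})=\big||X_1|-|X_{-1}|\big|$. *)

(* Defs.v *)
From mathcomp Require Import all_boot all_order all_algebra all_fingroup.

Set Implicit Arguments.
Unset Strict Implicit.
Unset Printing Implicit Defensive.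

Import GRing.Theory.

Section Graphs.
Variable V : finType.

(* A graph on V is given by its set of edges, each edge being the set of its
   two endpoints. *)
Definition simple_graph (E : {set {set V}}) : Prop :=
  forall A, A \in E -> #|A| = 2.

Definition adj (E : {set {set V}}) : rel V := fun u v => [set u; v] \in E.

(* A sequence [:: u; v] with u, v adjacent satisfies ucycle, hence the bound:
   the cycles of a simple graph have at least three vertices. *)
Definition forest (E : {set {set V}}) : Prop :=
  simple_graph E /\ forall c : seq V, ucycle (adj E) c -> size c < 3.

(* Either class may be empty, unlike for the blocks of finset.partition. *)
Definition edge_partition (E Erefl Erefr : {set {set V}}) : Prop :=
  E = Erefl :|: Erefr /\ [disjoint Erefl & Erefr].

Definition component (E : {set {set V}}) (v : V) : {set V} :=
  [set w | connect (adj E) v w].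

(* For a connected component with vertex set VT, the edges of the component
   are the edges included in VT. *)
Definition sign_partition (Erefl Erefr : {set {set V}}) (VT : {set V})
    (X : {set V} * {set V}) : bool :=
  [&& X.1 :|: X.2 == VT, [disjoint X.1 & X.2],
      [forall A in Erefr, (A \subset VT) ==>
         (#|A :&: X.1| == 1) && (#|A :&: X.2| == 1)] &
      [forall A in Erefl, (A \subset VT) ==>
         (A \subset X.1) || (A \subset X.2)]].

(* The value 0 is never taken by default on a component of a forest: there X
   exists and is unique up to swapping. *)
Definition chi (Erefl Erefr : {set {set V}}) (VT : {set V}) : nat :=
  if [pick X | sign_partition Erefl Erefr VT X] is Some X
  then `|(#|X.1|%:Z - #|X.2|%:Z)%R|%N else 0.

End Graphs.

(* Z/nZ is 'Z_n, which is the ring of integers mod n only for n > 1. *)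
Section Toric.
Variables (V : finType) (n : nat).

Definition is_labeling (s : {ffun V -> 'Z_n}) : bool :=
  injectiveb s && [forall j, exists v, s v == j].

Definition labeling := {s : {ffun V -> 'Z_n} | is_labeling s}.

Lemma labeling_surj (s : labeling) (j : 'Z_n) : exists v, val s v == j.
Proof. by have /andP[_ /forallP/(_ j)/existsP] := valP s. Qed.

Definition labeling_inv (s : labeling) (j : 'Z_n) : V :=
  xchoose (labeling_surj s j).

Definition s_ (i : 'Z_n) : {perm 'Z_n} := tperm i (i + 1)%R.

Lemma is_labeling_comp (p : {perm 'Z_n}) (s : labeling) :
  is_labeling [ffun v => p (val s v)].
Proof.
have /andP[/injectiveP sI /forallP sS] := valP s.
apply/andP; split.
  by apply/injectiveP => u v; rewrite !ffunE => /perm_inj/sI.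
apply/forallP => j; have /existsP[v /eqP sv] := sS (p^-1%g j).
by apply/existsP; exists v; rewrite ffunE sv permKV.
Qed.

Definition labeling_comp (p : {perm 'Z_n}) (s : labeling) : labeling :=
  Sub [ffun v => p (val s v)] (is_labeling_comp p s).

(* The last component b encodes the sign epsilon = (-1) ^+ b, so that
   false stands for 1 and true for -1. *)
Definition Xi : finType := (labeling * 'Z_n * bool)%type.

Definition Theta (Erefl Erefr : {set {set V}}) (x : Xi) : Xi :=
  let: (s, i, b) := x in
  let eps : 'Z_n := ((-1) ^+ b)%R in
  let A := [set labeling_inv s i; labeling_inv s (i + 1)%R] in
  if A \notin Erefl :|: Erefr then (labeling_comp (s_ i) s, i + eps, b)%R
  else if A \in Erefl then (s, i + eps, b)%R
  else (labeling_comp (s_ i) s, i - eps, ~~ b)%R.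

(* As Theta is a bijection of a finite set, its orbits are the sets of forward
   iterates enumerated by fingraph.orbit (not to be confused with the orbit of
   a group action, which shadows it). *)
Definition Theta_orbit (Erefl Erefr : {set {set V}}) (x : Xi) : {set Xi} :=
  [set y in fingraph.orbit (Theta Erefl Erefr) x].

(* The vertex labeled i + (1 - epsilon) / 2. *)
Definition base_vertex (x : Xi) : V :=
  let: (s, i, b) := x in labeling_inv s (if b then i + 1 else i)%R.

End Toric.

(* Main.v *)
(* Follow the base vertex v, which carries its label p around the circle in a
   direction epsilon past the other vertices. When it meets a neighbour w, it
   hands over to w; the base vertex thus walks on a tree, and can return to v
   only through w. By induction on the size of the branch of the tree hanging
   at w, during this excursion each vertex of the branch meets each of the n - 1
   others exactly once, and the cyclic order is restored, so that v goes on
   afterwards as if it had merely passed w. Hence after (n - 1)|V_T| steps the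
   configuration recurs up to a rotation; since each vertex moves in a direction
   given by its part X_1 or X_(-1), the rotation is by the opposite of the sum of
   the signs, i.e. chi up to sign, and has order n / gcd(n, chi). No earlier
   recurrence is possible: each u in T is at some time the base vertex, and then
   it occupies the n - 1 gaps between the others successively. *)

Require Import Defs.
From mathcomp Require Import all_boot all_order all_algebra all_fingroup.
From mathcomp Require Import ring zify.

Set Implicit Arguments.
Unset Strict Implicit.
Unset Printing Implicit Defensive.

Import GRing.Theory.
#[local] Arguments adj : simpl never.

(** * Branches of a forest *)

Section Forests.
Variable V : finType.
Implicit Types (E : {set {set V}}) (u v w x y : V).

Definition adj_off E v : rel V := [rel x y | [&& adj E x y, x != v & y != v]].

(** For an edge between [v] and [w] of a forest, this is the subtree hanging at [w] on the side away
    from [v]. *)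
Definition branch E v w : {set V} := [set y | connect (adj_off E v) w y].

Lemma adj_sym E : symmetric (adj E).
Proof. by move=> u v; rewrite /adj setUC. Qed.

Lemma adj_off_sym E v : symmetric (adj_off E v).
Proof. by move=> x y; rewrite /adj_off /= adj_sym [(x != v) && _]andbC. Qed.

Lemma adj_neq E u v : forest E -> adj E u v -> u != v.
Proof.
case=> sE _ /sE; apply: contra_eqN => /eqP->.
by rewrite setUid cards1.
Qed.

Lemma path_adj_off E v x p :
  path (adj E) x p -> v \notin x :: p -> path (adj_off E v) x p.
Proof.
elim: p x => //= y p IHp x /andP[xy Ep].
rewrite inE negb_or eq_sym => /andP[xv vp].
apply/andP; split; last exact: IHp.
by rewrite /adj_off /= xy xv; case/norP: vp => + _; rewrite eq_sym.
Qed.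

Lemma path_adj_off_notin E v x p :
  path (adj_off E v) x p -> x != v -> v \notin x :: p.
Proof.
elim: p x => [|y p IHp] x /=; first by rewrite inE eq_sym.
case/andP=> /and3P[_ _ yv] Ep xv.
by rewrite inE negb_or eq_sym xv IHp.
Qed.

Lemma branch_notin E v w : w != v -> v \notin branch E v w.
Proof.
move=> wv; rewrite inE; apply/negP => /connectP[p Ep vl].
have := path_adj_off_notin Ep wv; rewrite {1}vl.
by rewrite mem_last.
Qed.

(** If [x] and [y] differed, a path joining them off [v] would close up through [v] into a cycle of
    length at least three. *)
Lemma branch_inj E v x y :
  forest E -> adj E v x -> adj E v y -> y \in branch E v x -> x = y.
Proof.
move=> fE vx vy; rewrite inE => /connectP[p0 Ep0 yl].
have xv : x != v by rewrite eq_sym (adj_neq fE).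
case: (shortenP Ep0) yl => p Ep Up _ yl.
have vp := path_adj_off_notin Ep xv.
have Ep' : path (adj E) x p.
  by apply: sub_path Ep => a b /and3P[].
case: p Ep' Up yl vp {Ep Ep0} => //= z p Ep Up yl vp.
suff: size [:: v, x, z & p] < 3 by [].
case: fE => _; apply.
rewrite /ucycle; apply/andP; split.
  have: path (adj E) v (rcons [:: x, z & p] v); last by [].
  by rewrite rcons_path /= vx Ep -yl adj_sym.
by rewrite cons_uniq vp.
Qed.

Lemma branch_disjoint E v x y :
  forest E -> adj E v x -> adj E v y -> x != y ->
  [disjoint branch E v x & branch E v y].
Proof.
move=> fE vx vy; apply: contraR => /pred0Pn[z /andP[]].
rewrite !inE => xz yz; apply/eqP/(branch_inj fE vx vy).
rewrite inE (connect_trans xz) //.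
by rewrite (sym_connect_sym (adj_off_sym E v)).
Qed.

Lemma component_branch E v : forest E ->
  component E v = v |: \bigcup_(x | adj E v x) branch E v x.
Proof.
move=> fE; apply/setP => y; rewrite !inE; apply/idP/idP.
  case/connectP=> p0 Ep0; case/shortenP: Ep0 => p Ep Up _ ->.
  case: p Ep Up => [|x p] /=; first by rewrite eqxx.
  case/andP=> vx Ep /andP[vp _]; apply/orP; right.
  apply/bigcupP; exists x => //; rewrite inE; apply/connectP; exists p => //.
  exact: path_adj_off.
case/orP=> [/eqP-> // | /bigcupP[x vx]]; rewrite inE => xy.
apply: connect_trans (connect1 vx) _.
by apply: connect_sub xy => a b /and3P[ab _ _]; apply: connect1.
Qed.

(** A simple path from [w] never returns to [w], so after its first step it stays in one branch at
    [w]. This recursion underlies the induction on branches. *)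
Lemma branch_branch E v w : forest E -> adj E v w ->
  branch E v w = w |: \bigcup_(x | adj E w x && (x != v)) branch E w x.
Proof.
move=> fE vw; have wv : w != v by rewrite eq_sym (adj_neq fE).
have wv' : adj E w v by rewrite adj_sym.
apply/setP => y; rewrite !inE; apply/idP/idP.
  case/connectP=> p0 Ep0; case/shortenP: Ep0 => p Ep Up _ ->.
  case: p Ep Up => [|x p] /=; first by rewrite eqxx.
  case/andP=> /and3P[wx _ xv] Ep /andP[wp _]; apply/orP; right.
  apply/bigcupP; exists x; first by rewrite wx.
  rewrite inE; apply/connectP; exists p => //.
  apply: path_adj_off wp; apply: sub_path Ep => a b; by case/and3P.
case/orP=> [/eqP-> // | /bigcupP[x /andP[wx xv]]]; rewrite inE => /connectP[p Ep ->].
(* Since [v] is itself a neighbour of [w], it lies in no branch at [w] but its own. *)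
have v_far z : z \in branch E w x -> z != v.
  apply: contraTneq => ->; apply: contra xv => /(branch_inj fE wx wv') ->.
  exact: eqxx.
apply/connectP; exists (x :: p) => //=; rewrite {1}/adj_off /= wx wv xv /=.
apply: path_adj_off; first by apply: sub_path Ep => a b; case/and3P.
apply/negP => vp; suff /v_far: v \in branch E w x by rewrite eqxx.
by rewrite inE; apply: path_connect Ep _ vp.
Qed.

Section BranchSums.
Variables (R : Type) (idx : R) (op : Monoid.com_law idx).

(** The operation is abstract so as to serve both for cardinalities in [nat] and for sums of signs
    in ['Z_n]. *)
Lemma big_branches E v w (P : pred V) (F : V -> R) : forest E ->
  (forall x, P x -> adj E w x) ->
  \big[op/idx]_(y in w |: \bigcup_(x | P x) branch E w x) F y
  = op (F w) (\big[op/idx]_(x | P x) \big[op/idx]_(y in branch E w x) F y).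
Proof.
move=> fE PE; rewrite big_setU1 /=; last first.
  apply/bigcupP => -[x /PE wx]; apply/negP/branch_notin.
  by rewrite eq_sym (adj_neq fE).
(* Padding with empty sets makes the family pairwise disjoint over all indices. *)
congr (op _ _); pose G x := if P x then branch E w x else set0.
have -> : \bigcup_(x | P x) branch E w x = \bigcup_x G x.
  by rewrite big_mkcond.
rewrite partition_disjoint_bigcup; last first.
  move=> x y xy; rewrite /G.
  case: ifP => [/PE wx|_]; last by rewrite -setI_eq0 set0I.
  case: ifP => [/PE wy|_]; last by rewrite -setI_eq0 setI0.
  exact: branch_disjoint.
rewrite [RHS]big_mkcond; apply: eq_bigr => x _; rewrite /G.
by case: ifP => // _; rewrite big_set0.
Qed.

Lemma big_component E v (F : V -> R) : forest E ->
  \big[op/idx]_(y in component E v) F y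
  = op (F v) (\big[op/idx]_(x | adj E v x) \big[op/idx]_(y in branch E v x) F y).
Proof. by move=> fE; rewrite component_branch // big_branches. Qed.

Lemma big_branch E v w (F : V -> R) : forest E -> adj E v w ->
  \big[op/idx]_(y in branch E v w) F y
  = op (F w) (\big[op/idx]_(x | adj E w x && (x != v))
                 \big[op/idx]_(y in branch E w x) F y).
Proof.
by move=> fE vw; rewrite branch_branch // big_branches // => x /andP[].
Qed.

End BranchSums.

Lemma card_branch_lt E v w x :
  forest E -> adj E v w -> adj E w x -> x != v ->
  #|branch E w x| < #|branch E v w|.
Proof.
move=> fE vw wx xv; apply/proper_card/properP; split.
  rewrite (branch_branch fE vw); apply: subsetU.
  by apply/orP; right; apply: bigcup_sup; rewrite wx.
exists w; first by rewrite inE connect0.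
by apply: branch_notin; rewrite eq_sym (adj_neq fE).
Qed.

(** * Two-colourings of a forest with prescribed changes along the edges *)

Lemma forest_sub E E' : E' \subset E -> forest E -> forest E'.
Proof.
move=> /subsetP sE [s2 cE]; split=> [A /sE/s2 // | c /andP[Ec Uc]].
apply: cE; rewrite /ucycle Uc andbT.
by apply: sub_cycle Ec => a b; apply: sE.
Qed.

Lemma forest_bridge E A u v : forest E -> A \in E -> A = [set u; v] ->
  ~~ connect (adj (E :\ A)) u v.
Proof.
move=> fE AE AE2; apply/negP => /connectP[p0 Ep0].
case/shortenP: Ep0 => p Ep Up _ vl.
have uv : adj E u v by rewrite /adj -AE2.
have Ep' : path (adj E) u p by apply: sub_path Ep => a b; case/setD1P.
case: p Ep Ep' Up vl => [|x [|y p]] /=.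
- by move=> _ _ _ vu; have := adj_neq fE uv; rewrite vu eqxx.
- by rewrite /adj in_setD1 AE2 => /andP[/andP[/eqP xu _] _] _ _ vx; case: xu; rewrite vx.
move=> _ Ep Up vl; suff: size [:: u, x, y & p] < 3 by [].
case: fE => _; apply; apply/andP; split=> //.
have: path (adj E) u (rcons [:: x, y & p] u); last by [].
by rewrite rcons_path /= Ep -vl adj_sym.
Qed.

(** Induction on the number of edges: remove an edge [A], colour the rest, and flip one side of the
    bridge [A] if the colouring is wrong there. *)
Lemma forest_bicoloring E (r : pred {set V}) : forest E ->
  exists d : V -> bool,
    forall u v, [set u; v] \in E -> d u (+) d v = r [set u; v].
Proof.
move cE: #|E| => m; elim: m E cE => [|m IHm] E cE fE.
  by exists (fun=> false) => u v; rewrite (cards0_eq cE) inE.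
have [A AE] : exists A, A \in E by apply/set0Pn; rewrite -card_gt0 cE.
have /cards2P[u [v [uv Auv]]] : #|A| == 2 by case: fE => s2 _; rewrite s2.
have [|d dE] := IHm (E :\ A) _ (forest_sub (subsetDl E [set A]) fE).
  by move: cE; rewrite (cardsD1 A) AE => -[].
(* [C] is the side of [u] after the removal of [A]; [f] is true exactly when [d] is wrong on [A]. *)
pose C := component (E :\ A) u; pose f := d u (+) d v (+) r A.
exists (fun x => d x (+) (f && (x \in C))); move=> x y xyE.
have [xyA | xyA] := eqVneq [set x; y] A; last first.
  have xyE' : [set x; y] \in E :\ A by rewrite !inE xyA.
  rewrite addbACA dE // -andb_addr.
  suff -> : (x \in C) = (y \in C) by rewrite addbb andbF addbF.
  rewrite !inE; apply/idP/idP => /connect_trans; apply; apply: connect1 => //.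
  by rewrite adj_sym.
have vC : v \notin C by rewrite inE (forest_bridge fE AE Auv).
have uC : u \in C by rewrite inE connect0.
have: [set x; y] = [set u; v] by rewrite xyA.
have xy : x != y by move: (xyE); apply: adj_neq fE.
move=> eq2; have /set2P xuv : x \in [set u; v] by rewrite -eq2 set21.
have /set2P yuv : y \in [set u; v] by rewrite -eq2 set22.
rewrite xyA; case: yuv xuv => yE [] xE.
- by rewrite yE xE eqxx in xy.
- rewrite xE yE uC (negPf vC) andbT andbF addbF /f.
  by case: (d u) (d v) (r A) => [] [] [].
- rewrite xE yE uC (negPf vC) andbT andbF addbF /f.
  by case: (d u) (d v) (r A) => [] [] [].
by rewrite yE xE eqxx in xy.
Qed.

End Forests.

(** * The walk of the base vertex *)

Section Walk.
Variables (V : finType) (n : nat) (Erefl Erefr : {set {set V}}).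
Local Notation E := (Erefl :|: Erefr).

(* A state (p, v, M, b) records the label p of the base vertex v, the other
   vertices M in the order in which a walker starting at p in the direction
   (-1) ^+ b meets them, and b itself. *)
Definition step (x : 'Z_n * V * seq V * bool) : 'Z_n * V * seq V * bool :=
  let: (p, v, M, b) := x in
  if M is u :: M' then
    if [set v; u] \notin E then (p + (-1) ^+ b, v, rcons M' u, b)%R
    else if [set v; u] \in Erefl then (p + (-1) ^+ b, u, rcons M' v, b)%R
    else (p, u, rcons (rev M') v, ~~ b)
  else x.

Variable d : V -> bool.
Local Notation e y := ((-1) ^+ d y : 'Z_n)%R.

(** The 1 is the meeting of [v] with [u]; if they are adjacent, each vertex of the branch at [u]
    adds its own [n - 1] meetings. *)
Definition pass_time (v u : V) : nat :=
  1 + (if adj E v u then n.-1 * #|branch E v u| else 0).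

(** The minus sign arises because [n - 1] moves in the direction [e y] amount to [- e y] modulo
    [n]. *)
Definition pass_shift (v u : V) : 'Z_n :=
  (e v - (if adj E v u then \sum_(y in branch E v u) e y else 0))%R.

(* Meeting u, the base vertex v eventually goes on as if u were an ordinary
   obstacle, whatever excursion into the branch of u occurs in between. *)
Definition passes (v u : V) := forall p M,
  perm_eq [:: v, u & M] (enum V) ->
  iter (pass_time v u) step (p, v, u :: M, d v)
  = (p + pass_shift v u, v, rcons M u, d v)%R.

(** The suffix [t] allows a sweep to be interrupted: just before the parent in [passes_adj], before
    a chosen neighbour in [reach_neighbor], at an arbitrary gap in [Theta_orbit_ge]. *)
Lemma passes_seq v s t p : {in s, forall u, passes v u} ->
  perm_eq (v :: s ++ t) (enum V) ->
  iter (\sum_(u <- s) pass_time v u) step (p, v, s ++ t, d v)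
  = (p + \sum_(u <- s) pass_shift v u, v, t ++ s, d v)%R.
Proof.
elim: s t p => [|u s IHs] t p /= vs st; first by rewrite !big_nil addr0 cats0.
rewrite !big_cons addnC iterD (vs _ (mem_head _ _)) //.
rewrite rcons_cat IHs; last 2 first.
- by move=> x xs; apply: vs; rewrite inE xs orbT.
- apply: perm_trans st; rewrite perm_cons -rcons_cat -cats1 perm_catC.
  exact: perm_refl.
by rewrite -(addrA p) cat_rcons.
Qed.

Hypothesis n_gt1 : 1 < n.
Hypothesis cardV : #|V| = n.
Hypothesis fE : forest E.
Hypothesis dE : forall u v, [set u; v] \in E ->
  d u (+) d v = ([set u; v] \notin Erefl).

(** * Duration and shift of a sweep *)

Lemma big_others (R : Type) (idx : R) (op : Monoid.com_law idx)
    (s t : seq V) (F : V -> R) : perm_eq (s ++ t) (enum V) ->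
  \big[op/idx]_(u <- t) F u = \big[op/idx]_(u | u \notin s) F u.
Proof.
move=> st; transitivity (\big[op/idx]_(u <- s ++ t | u \notin s) F u).
  rewrite big_cat /= [X in op X _]big_seq_cond [X in op X _]big1 => [|u];
    last by case: (u \in s).
  rewrite Monoid.mul1m big_seq [RHS]big_seq_cond; apply: eq_bigl => u.
  have := enum_uniq V; rewrite -(perm_uniq st) cat_uniq => /and3P[_ /hasPn st' _].
  by case ut: (u \in t) => //=; rewrite (st' u ut).
by rewrite (perm_big _ st) big_enum_cond.
Qed.

Lemma size_others (s t : seq V) : perm_eq (s ++ t) (enum V) ->
  size s + size t = n.
Proof. by move/perm_size; rewrite size_cat -cardE cardV. Qed.

(** The excluded list [s] consists of the base vertex alone for a full revolution, and also of its
    parent for an excursion. *)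
Lemma sum_pass_time v s t : perm_eq (s ++ t) (enum V) ->
  \sum_(u <- t) pass_time v u
  = size t + n.-1 * \sum_(u | adj E v u && (u \notin s)) #|branch E v u|.
Proof.
move=> st; rewrite big_split /= sum1_size; congr (_ + _).
rewrite (big_others _ _ st) big_distrr /= [RHS]big_mkcondl /=.
by apply: eq_bigr => u _; case: ifP.
Qed.

Lemma sum_pass_shift v s t : perm_eq (s ++ t) (enum V) ->
  (\sum_(u <- t) pass_shift v u
  = e v *+ size t
    - \sum_(u | adj E v u && (u \notin s)) \sum_(y in branch E v u) e y)%R.
Proof.
move=> st; rewrite big_split /= big_const_seq count_predT iter_addr_0.
rewrite sumrN (big_others _ _ st) [in RHS]big_mkcondl /=.
congr (_ - _)%R.
Qed.

Lemma adj_notin1 v u : adj E v u && (u \notin [:: v]) = adj E v u.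
Proof.
rewrite inE; case vu: (adj E v u) => //=.
by rewrite eq_sym (adj_neq fE).
Qed.

Lemma adj_notin2 v w u :
  adj E w u && (u \notin [:: v; w]) = adj E w u && (u != v).
Proof.
rewrite !inE negb_or; case wu: (adj E w u) => //=.
by rewrite (eq_sym u w) (adj_neq fE wu) andbT.
Qed.

Lemma sum_pass_time_component v M : perm_eq (v :: M) (enum V) ->
  \sum_(u <- M) pass_time v u = n.-1 * #|component E v|.
Proof.
move=> vM; rewrite (sum_pass_time v (s := [:: v]) vM).
rewrite (eq_bigl (adj E v)) => [|u]; last exact: adj_notin1.
rewrite -sum1_card (big_component _ _ _ fE) mulnDr muln1.
rewrite -(size_others (s := [:: v]) vM) /=.
by congr (_ + _ * _); apply: eq_bigr => u _; rewrite sum1_card.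
Qed.

(** The two extra steps are the handovers from [v] to [w] and back; in between, [w] sweeps the
    [n - 2] vertices of [M]. *)
Lemma sum_pass_time_branch v w M : adj E v w ->
  perm_eq [:: v, w & M] (enum V) ->
  (\sum_(u <- M) pass_time w u).+2 = pass_time v w.
Proof.
move=> vw vwM; rewrite (sum_pass_time w (s := [:: v; w]) vwM).
rewrite (eq_bigl _ _ (adj_notin2 v w)) /pass_time vw.
rewrite -sum1_card (big_branch _ _ fE vw) mulnDr muln1.
rewrite -(size_others (s := [:: v; w]) vwM) /= add1n -!addSn.
by congr (_ + _ * _); apply: eq_bigr => u _; rewrite sum1_card.
Qed.

Lemma mulrZp0 (x : 'Z_n) : (x *+ n = 0)%R.
Proof. by rewrite -mulr_natr pchar_Zp ?mulr0. Qed.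

Lemma sum_pass_shift_component v M : perm_eq (v :: M) (enum V) ->
  (\sum_(u <- M) pass_shift v u = - \sum_(y in component E v) e y)%R.
Proof.
move=> vM; rewrite (sum_pass_shift v (s := [:: v]) vM).
rewrite (eq_bigl _ _ (adj_notin1 v)).
rewrite (big_component _ _ _ fE) opprD; congr (_ - _)%R.
(* The [n - 1] moves of [v] itself amount to [- e v]. *)
apply/eqP; rewrite -addr_eq0 -mulrSr.
by have /= := size_others (s := [:: v]) vM; rewrite add1n => ->; rewrite mulrZp0.
Qed.

Lemma sum_pass_shift_branch v w M : adj E v w ->
  perm_eq [:: v, w & M] (enum V) ->
  (\sum_(u <- M) pass_shift w u = - e w - \sum_(y in branch E v w) e y)%R.
Proof.
move=> vw vwM; rewrite (sum_pass_shift w (s := [:: v; w]) vwM).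
rewrite (eq_bigl _ _ (adj_notin2 v w)) (big_branch _ _ fE vw) opprD addrA.
congr (_ - _)%R; apply/eqP; rewrite -subr_eq0 !opprD !opprK addrA -!mulrSr.
by have /= := size_others (s := [:: v; w]) vwM; rewrite add2n => ->; rewrite mulrZp0.
Qed.

Lemma signZ_neq (b c : bool) : b != c -> ((-1) ^+ b = - (-1) ^+ c :> 'Z_n)%R.
Proof. by case: b c => [] [] //= _; rewrite expr0 expr1 ?opprK. Qed.

(* Having handed over to w, the walk can only come back to v through w, after w
   has met every other vertex once; by induction on the branch these meetings
   restore the cyclic order. *)
Lemma passes_adj v w : adj E v w -> passes v w.
Proof.
have [m] := ubnP #|branch E v w|; elim: m v w => // m IHm v w + vw.
rewrite ltnS => lt_m p M vwM.
have wv : adj E w v by rewrite adj_sym.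
(* The order of [M'] is left free because [w] sweeps [rev M] after a refraction. *)
have wM (M' : seq V) : M' =i M -> {in M', forall u, passes w u}.
  move=> eqM u; rewrite eqM => uM; case wu: (adj E w u); last first.
    move=> q N _; rewrite /pass_time /pass_shift wu /=.
    by rewrite [_ \notin _](negbT wu) subr0.
  apply: IHm => //; apply: leq_trans (card_branch_lt fE vw wu _) lt_m.
  have := enum_uniq V; rewrite -(perm_uniq vwM) /= inE negb_or -andbA.
  by case/and3P=> _ + _; apply: contraNneq => <-.
have wvM (M' : seq V) : perm_eq M' M -> perm_eq (w :: M' ++ [:: v]) (enum V).
  move=> M'M; apply: perm_trans vwM; rewrite -cat1s catA perm_catC /=.
  by rewrite perm_cons perm_cons.
have vwE : [set v; w] \in E by [].
have wvE : [set w; v] \in E by [].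
have wvr : ([set w; v] \in Erefl) = ([set v; w] \in Erefl) by rewrite setUC.
have shiftE : (pass_shift v w = e v - \sum_(y in branch E v w) e y)%R.
  by rewrite /pass_shift vw.
(* The first and last steps, which are the two handovers, are split off from the sweep by [w]. *)
rewrite -(sum_pass_time_branch vw vwM) iterSr iterS [step (_, _, _ :: _, _)]/=.
rewrite vwE shiftE /=; have [vwr | vwr] := boolP ([set v; w] \in Erefl).
  have dvw : d v = d w by have := dE vwE; rewrite vwr; case: (d v) (d w) => [] [].
  rewrite dvw -cats1 passes_seq; [|exact: wM|exact: wvM].
  rewrite (sum_pass_shift_branch vw vwM) /= wvE wvr vwr /=.
  congr (_, _, _, _); ring.
have dvw : d v != d w by have := dE vwE; rewrite vwr; case: (d v) (d w) => [] [].
have -> : ~~ d v = d w by case: (d v) (d w) dvw => [] [].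
have revM : perm_eq (rev M) M by rewrite perm_rev.
rewrite -cats1 -(perm_big _ revM) /=.
rewrite passes_seq; [|exact: wM (perm_mem revM)|exact: wvM].
rewrite (perm_big _ revM) /= (sum_pass_shift_branch vw vwM) wvE wvr (negPf vwr) /=.
rewrite revK; have -> : ~~ d w = d v by case: (d v) (d w) dvw => [] [].
(* Neither handover across a refraction edge moves [p], which agrees with [e v + e w = 0]. *)
by congr (_, _, _, _); rewrite (signZ_neq dvw).
Qed.

Lemma passes_all v u : passes v u.
Proof.
case vu: (adj E v u); first exact: passes_adj.
move=> p M _; rewrite /pass_time /pass_shift vu /=.
by rewrite [_ \notin _](negbT vu) subr0.
Qed.

End Walk.

(** * The walk encodes Theta *)

Lemma mkseq_cons (T : Type) (f : nat -> T) m :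
  mkseq f m.+1 = f 0 :: mkseq (fun k => f k.+1) m.
Proof. by rewrite /mkseq /= -[1]addn0 iotaDl -map_comp. Qed.

Section Coding.
Variables (V : finType) (n : nat).
Implicit Types (s : labeling V n) (x y : Xi V n) (j : 'Z_n).

Lemma labeling_invK s : cancel (labeling_inv s) (val s).
Proof. by move=> j; apply/eqP/(xchooseP (labeling_surj s j)). Qed.

Lemma labelingK s : cancel (val s) (labeling_inv s).
Proof.
move=> v; have /andP[/injectiveP sI _] := valP s.
by apply: sI; rewrite labeling_invK.
Qed.

Lemma labeling_inv_comp (f : {perm 'Z_n}) s j :
  labeling_inv (labeling_comp f s) (f j) = labeling_inv s j.
Proof.
apply: (can_inj (labelingK (labeling_comp f s))).
by rewrite labeling_invK /= ffunE labeling_invK.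
Qed.

Definition base_label x : 'Z_n :=
  let: (_, i, b) := x in if b then (i + 1)%R else i.

Definition seen_label x (k : nat) : 'Z_n := (base_label x + (-1) ^+ x.2 * k%:R)%R.

Definition seen x (k : nat) : V := labeling_inv x.1.1 (seen_label x k).

Definition code x : 'Z_n * V * seq V * bool :=
  (base_label x, seen x 0, mkseq (fun k => seen x k.+1) n.-1, x.2).

Lemma seen0 x : seen x 0 = base_vertex x.
Proof. by case: x => [[s i] b]; rewrite /seen /seen_label mulr0 addr0. Qed.

Hypothesis n_gt1 : 1 < n.

Lemma seen_label_inj x k l : k < n -> l < n ->
  seen_label x k = seen_label x l -> k = l.
Proof.
move=> kn ln /addrI/(congr1 (fun z => (-1) ^+ x.2 * z)%R).
rewrite !mulrA -expr2 sqrr_sign !mul1r => /(congr1 val).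
by rewrite /= !val_Zp_nat // !modn_small.
Qed.

Lemma seen_label_surj x j : exists2 k, k < n & j = seen_label x k.
Proof.
exists (val ((-1) ^+ x.2 * (j - base_label x))%R).
  by rewrite -[X in _ < X](Zp_cast n_gt1) ltn_ord.
by rewrite /seen_label natr_Zp mulrA -expr2 sqrr_sign mul1r addrC subrK.
Qed.

(** Every label is seen at some distance below [n], so the list of seen vertices determines the
    labeling. Thus a recurrence of the walk is a recurrence of [Theta]. *)
Lemma code_inj : injective code.
Proof.
move=> x y [] xy_p xy0 xyM xy_b.
have xy_seen k : k < n -> seen x k = seen y k.
  case: k => // k kn; have kn' : k < n.-1 by lia.
  by have := congr1 (fun M => nth (seen x 0) M k) xyM; rewrite !nth_mkseq.
have xy_lab k : seen_label x k = seen_label y k.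
  by rewrite /seen_label xy_p xy_b.
have xy_s : x.1.1 = y.1.1.
  apply/val_inj/ffunP => v; have [k kn vk] := seen_label_surj x (val x.1.1 v).
  have := xy_seen k kn; rewrite {1}/seen -vk labelingK => vE.
  by rewrite vk xy_lab [in RHS]vE labeling_invK.
case: x y xy_p xy_s xy_b {xy0 xyM xy_seen xy_lab} => [[s i] b] [[s' i'] b'] /=.
by move=> + -> bb'; rewrite -bb'; case: b {bb'} => [/addIr|] ->.
Qed.

Lemma seen_label_n x k : k = n -> seen_label x k = seen_label x 0.
Proof. by move->; rewrite /seen_label pchar_Zp. Qed.

Lemma code_head x :
  mkseq (fun k => seen x k.+1) n.-1
  = seen x 1 :: mkseq (fun k => seen x k.+2) n.-2.
Proof.
have -> : n.-1 = n.-2.+1 by lia.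
exact: mkseq_cons.
Qed.

Hypothesis cardV : #|V| = n.

Lemma code_perm x :
  perm_eq (seen x 0 :: mkseq (fun k => seen x k.+1) n.-1) (enum V).
Proof.
have -> : seen x 0 :: mkseq (fun k => seen x k.+1) n.-1 = mkseq (seen x) n.
  have nE : n = n.-1.+1 by lia.
  by rewrite [in RHS]nE mkseq_cons.
have Us : uniq (mkseq (seen x) n).
  rewrite map_inj_in_uniq ?iota_uniq // => k l.
  rewrite !mem_iota => /= kn ln /(can_inj (labeling_invK _)).
  exact: seen_label_inj.
apply: uniq_perm => //; first exact: enum_uniq.
have [] // := uniq_min_size (s2 := enum V) Us.
  by move=> v _; rewrite mem_enum.
by rewrite size_mkseq -cardE cardV.
Qed.

Variables (Erefl Erefr : {set {set V}}).

(** For either sign, the labels [i] and [i + 1] are the first two seen from the base, so a swap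
    affects only the first two vertices. Going on shifts the sequence of seen labels by one; turning
    back reads it in reverse. *)
Lemma code_Theta x : code (Theta Erefl Erefr x) = step Erefl Erefr (code x).
Proof.
rewrite [in RHS]/code code_head.
have labS k : seen_label x k.+1 = (seen_label x k + (-1) ^+ x.2)%R.
  by rewrite /seen_label mulrSr mulrDr mulr1 addrA.
have lab0 : seen_label x 0 = base_label x by rewrite /seen_label mulr0 addr0.
have swapE : s_ x.1.2 = tperm (seen_label x 0) (seen_label x 1).
  rewrite labS lab0; case: (x) => [[s i] []] //=.
  by rewrite /s_ expr1 addrK tpermC.
have edgeE : [set labeling_inv x.1.1 x.1.2; labeling_inv x.1.1 (x.1.2 + 1)%R]
             = [set seen x 0; seen x 1].
  rewrite /seen labS lab0; case: (x) => [[s i] []] //=.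
  by rewrite expr1 addrK setUC.
have swap_inv j : labeling_inv (labeling_comp (s_ x.1.2) x.1.1) j
    = labeling_inv x.1.1 (tperm (seen_label x 0) (seen_label x 1) j).
  rewrite -[in LHS](tpermK (seen_label x 0) (seen_label x 1) j) -swapE.
  exact: labeling_inv_comp.
have seen_swap k : 1 < k < n ->
    labeling_inv (labeling_comp (s_ x.1.2) x.1.1) (seen_label x k) = seen x k.
  case/andP=> k1 kn; rewrite swap_inv tpermD //.
    by apply: contraTneq k1 => /(seen_label_inj (ltnW n_gt1) kn) <-.
  by apply: contraTneq k1 => /(seen_label_inj n_gt1 kn) <-.
pose x1 s : Xi V n := (s, x.1.2 + (-1) ^+ x.2, x.2)%R.
pose x2 s : Xi V n := (s, x.1.2 - (-1) ^+ x.2, ~~ x.2)%R.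
have x1_lab s k : seen_label (x1 s) k = seen_label x k.+1.
  rewrite labS /seen_label /x1; case: (x) => [[s' i] []] /=; ring.
(* Turning back keeps the base label, and distance [k] in the new direction is distance [n - k] in
   the old one. *)
have x2_lab s k : k <= n -> seen_label (x2 s) k = seen_label x (n - k).
  move=> kn; rewrite /seen_label /x2 natrB // pchar_Zp // sub0r.
  case: (x) => [[s' i] []] /=; ring.
have -> : Theta Erefl Erefr x =
  if [set seen x 0; seen x 1] \notin Erefl :|: Erefr
  then x1 (labeling_comp (s_ x.1.2) x.1.1)
  else if [set seen x 0; seen x 1] \in Erefl then x1 x.1.1
  else x2 (labeling_comp (s_ x.1.2) x.1.1).
  by rewrite -edgeE /x1 /x2; case: (x) => [[s i] b].
have n2 : n.-1 = n.-2.+1 by lia.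
have base1 s : base_label (x1 s) = (base_label x + (-1) ^+ x.2)%R.
  by rewrite /x1; case: (x) => [[s' i] []] /=; ring.
have base2 s : base_label (x2 s) = base_label x.
  by rewrite /x2; case: (x) => [[s' i] []] /=; ring.
rewrite /= -/(seen x 0) -/(seen x 1); case: ifP => _; last case: ifP => _.
- rewrite /code base1 n2 mkseqS; congr (_, _, rcons _ _, _).
  + by rewrite /seen x1_lab swap_inv tpermR.
  + apply/eq_in_map => k; rewrite mem_iota => /= kn.
    by rewrite /seen x1_lab seen_swap //; lia.
  (* The last vertex sits at distance [n], that is, at the former base label, which the swap has
     given to [seen x 1]. *)
  by rewrite /seen x1_lab seen_label_n ?swap_inv ?tpermL //; lia.
- rewrite /code base1 n2 mkseqS; congr (_, _, rcons _ _, _).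
  + by rewrite /seen x1_lab.
  + by apply/eq_in_map => k _; rewrite /seen x1_lab.
  by rewrite /seen x1_lab seen_label_n //; lia.
rewrite /code base2 n2 mkseqS; congr (_, _, rcons _ _, _).
- by rewrite /seen x2_lab // subn0 seen_label_n // swap_inv tpermL.
- apply: (eq_from_nth (x0 := seen x 0)); first by rewrite size_rev !size_mkseq.
  move=> k; rewrite size_mkseq => kn.
  rewrite nth_rev ?size_mkseq // !nth_mkseq //; last by lia.
  rewrite /seen x2_lab ?seen_swap //; try lia.
  congr (labeling_inv _ (seen_label _ _)); lia.
rewrite /seen x2_lab; last by lia.
by rewrite (_ : n - n.-2.+1 = 1) ?swap_inv ?tpermR //; lia.
Qed.

End Coding.

(** * Size of the orbits *)

Section OrbitSize.
Variables (V : finType) (n : nat) (Erefl Erefr : {set {set V}}).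
Local Notation E := (Erefl :|: Erefr).
Variable d : V -> bool.
Local Notation e y := ((-1) ^+ d y : 'Z_n)%R.
Local Notation F := (@Theta V n Erefl Erefr).
Local Notation step := (@step V n Erefl Erefr).
Local Notation pass_time := (@pass_time V n Erefl Erefr).
Local Notation pass_shift := (@pass_shift V n Erefl Erefr d).

Hypothesis n_gt1 : 1 < n.
Hypothesis cardV : #|V| = n.
Hypothesis fE : forest E.
Hypothesis dE : forall u v, [set u; v] \in E ->
  d u (+) d v = ([set u; v] \notin Erefl).

(** Each revolution rotates the configuration by the opposite of this sum; [chi_signing] relates it
    to [chi]. *)
Definition drift v : 'Z_n := (\sum_(y in component E v) e y)%R.

Lemma component_eq u v : u \in component E v -> component E u = component E v.
Proof.
rewrite inE => vu; apply/setP => w; rewrite !inE.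
by rewrite (same_connect (sym_connect_sym (@adj_sym _ E)) vu).
Qed.

(** A sweep with empty suffix restores the list [M], so that only the base label changes. *)
Lemma iter_revolution v M p t : perm_eq (v :: M) (enum V) ->
  iter (t * (n.-1 * #|component E v|)) step (p, v, M, d v)
  = (p - drift v *+ t, v, M, d v)%R.
Proof.
move=> vM.
have sweep q : iter (n.-1 * #|component E v|) step (q, v, M, d v)
               = (q - drift v, v, M, d v)%R.
  have := @passes_seq _ n Erefl Erefr d v M [::] q; rewrite cats0.
  rewrite (sum_pass_time_component cardV fE vM) => -> //.
    by rewrite (sum_pass_shift_component d n_gt1 cardV fE vM).
  by move=> u _; apply: passes_all.
elim: t p => [|t IHt] p; first by rewrite mulr0n subr0.
by rewrite mulSn addnC iterD sweep IHt mulrS opprD addrA.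
Qed.

Lemma code_iter k x : code (iter k F x) = iter k step (code x).
Proof. by elim: k => //= k <-; apply: code_Theta. Qed.

Definition others (x : Xi V n) := mkseq (fun k => seen x k.+1) n.-1.

(* Alignment persists along the orbit: the direction flips exactly when the base
   vertex moves across a refraction edge, as d does. *)
Definition aligned (x : Xi V n) := x.2 == d (base_vertex x).

Lemma code_aligned x : aligned x ->
  code x = (base_label x, base_vertex x, others x, d (base_vertex x)).
Proof. by rewrite /code seen0 => /eqP->. Qed.

Lemma others_perm x : perm_eq (base_vertex x :: others x) (enum V).
Proof. by rewrite -seen0; apply: code_perm. Qed.

Lemma others_uniq x : uniq (others x).
Proof.
by have := enum_uniq V; rewrite -(perm_uniq (others_perm x)) => /andP[].
Qed.

Lemma iter_orbit_period N x k : iter N F x = x -> iter k F x = iter (k %% N) F x.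
Proof.
move=> xN; rewrite {1}(divn_eq k N) addnC iterD; congr (iter _ _ _).
by elim: (k %/ N) => // q IHq; rewrite mulSn iterD IHq.
Qed.

(** The base vertex sweeps all that precedes [w] in its list; the next step is the handover to
    [w]. *)
Lemma reach_neighbor x w : aligned x -> adj E (base_vertex x) w ->
  exists y, [/\ fconnect F x y, base_vertex y = w & aligned y].
Proof.
move=> ax vw; set v := base_vertex x in vw.
have xM := others_perm x.
have wM : w \in others x.
  have: w \in enum V by rewrite mem_enum.
  rewrite -(perm_mem xM) inE => /predU1P[wv|//].
  by have := adj_neq fE vw; rewrite wv eqxx.
have := code_aligned ax; rewrite -/v.
case/splitPr: wM xM => A B; rewrite -/v => xM cx.
pose k := \sum_(u <- A) pass_time v u.
have ck : code (iter k F x)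
    = (base_label x + \sum_(u <- A) pass_shift v u, v, w :: B ++ A, d v)%R.
  by rewrite code_iter cx passes_seq // => u _; apply: passes_all.
exists (iter k.+1 F x).
suff: exists p N, code (iter k.+1 F x) = (p, w, N, d w).
  case=> p [N] []; rewrite -/(iter k.+1 F x) => _ yw _ yb.
  rewrite seen0 in yw.
  by split; rewrite ?fconnect_iter // /aligned yb yw.
have vwE : [set v; w] \in E by [].
rewrite iterS code_Theta // ck /= vwE /=.
(* The direction flips exactly when the edge is not a reflection edge, as [d] does, so alignment is
   kept. *)
have := dE vwE; case: ifP => _ dvw; do 2!eexists; congr (_, _, _, _);
  by case: (d v) (d w) dvw => [] [].
Qed.

Lemma reach_component x u : aligned x -> u \in component E (base_vertex x) ->
  exists y, [/\ fconnect F x y, base_vertex y = u & aligned y].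
Proof.
rewrite inE => + /connectP[q]; elim: q x => [|w q IHq] x ax /=.
  by move=> _ ->; exists x.
case/andP=> /(reach_neighbor ax)[y [xy <- ay]] /IHq{}IHq /IHq[//|z [yz zu az]].
by exists z; split=> //; apply: connect_trans yz.
Qed.

(** Here [m] stands for the additive order of the drift: the number of revolutions until the
    rotation is trivial. *)
Variables (m : nat) (x : Xi V n).
Hypothesis m_gt0 : 0 < m.
Hypothesis driftE : forall t,
  (drift (base_vertex x) *+ t == 0)%R = (m %| t).
Hypothesis x_aligned : aligned x.
Local Notation v := (base_vertex x).
Local Notation N := (m * (n.-1 * #|component E v|)).

Lemma iter_period : iter N F x = x.
Proof.
apply: (code_inj n_gt1); rewrite code_iter code_aligned //.
rewrite iter_revolution ?others_perm //.
by have := driftE m; rewrite dvdnn => /eqP->; rewrite subr0.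
Qed.

Lemma Theta_orbit_le : #|Theta_orbit Erefl Erefr x| <= N.
Proof.
have N_gt0 : 0 < N.
  have n1_gt0 : 0 < n.-1 by lia.
  rewrite !muln_gt0 m_gt0 n1_gt0 /=.
  by apply/card_gt0P; exists v; rewrite inE connect0.
apply: (@leq_trans #|[set iter k F x | k : 'I_N]|).
  apply: subset_leq_card; apply/subsetP => y; rewrite inE -fconnect_orbit => xy.
  apply/imsetP; exists (Ordinal (ltn_pmod (findex F x y) N_gt0)) => //=.
  by rewrite -iter_orbit_period ?iter_findex // iter_period.
by rewrite (leq_trans (leq_imset_card _ _)) // card_ord.
Qed.

Lemma drift_inj t t' : t < m -> t' < m ->
  (drift v *+ t = drift v *+ t')%R -> t = t'.
Proof.
wlog tt' : t t' / t <= t' => [IH tm tm' eq|].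
  by have [/IH|/ltnW/IH] := leqP t t'; [|symmetry]; auto.
move=> tm tm' eq_t; apply/eqP; rewrite eqn_leq tt' /= -subn_eq0.
have : m %| t' - t by rewrite -driftE mulrnBr // eq_t subrr.
by rewrite /dvdn modn_small // ltn_subLR // ltn_addl.
Qed.

(** Triples of a vertex [u] of the component, a gap [j] and a number [t] of revolutions inject into
    the orbit: start from an orbit point [Y u] with base [u], sweep [j] vertices, then make [t]
    revolutions. *)
Lemma Theta_orbit_ge : N <= #|Theta_orbit Erefl Erefr x|.
Proof.
pose at_ u (y : Xi V n) := [&& fconnect F x y, base_vertex y == u & aligned y].
pose Y u := odflt x [pick y | at_ u y].
have YP u : u \in component E v -> at_ u (Y u).
  move=> /(reach_component x_aligned)[y [xy /eqP yu ay]].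
  by rewrite /Y; case: pickP => // /(_ y); rewrite /at_ xy yu ay.
pose f (z : V * ('I_n.-1 * 'I_m)) := let: (u, (j, t)) := z in
  iter (t * (n.-1 * #|component E u|)
        + \sum_(w <- take j (others (Y u))) pass_time u w) F (Y u).
pose D := setX (component E v) [set: 'I_n.-1 * 'I_m].
have fP u (j : 'I_n.-1) (t : 'I_m) : u \in component E v ->
  code (f (u, (j, t))) =
  (base_label (Y u) + \sum_(w <- take j (others (Y u))) pass_shift u w
     - drift v *+ t, u, rot j (others (Y u)), d u)%R.
  move=> uT; have /and3P[_ /eqP yu ay] := YP u uT.
  have yM := others_perm (Y u); rewrite yu in yM.
  rewrite /f code_iter code_aligned // yu iterD.
  rewrite -{2}(cat_take_drop j (others (Y u))) passes_seq ?cat_take_drop //.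
    rewrite iter_revolution /drift ?(component_eq uT) //.
    by apply: perm_trans yM; rewrite perm_cons perm_rot.
  by move=> w _; apply: passes_all.
have f_inj : {in D &, injective f}.
  move=> [u [j t]] [u' [j' t']] /setXP[/= uT _] /setXP[/= uT' _].
  move/(congr1 (@code _ _)); rewrite !fP // => eq_code.
  have eq_p := congr1 (fun c => c.1.1.1) eq_code.
  have /= eq_u := congr1 (fun c => c.1.1.2) eq_code.
  have /= rot_j := congr1 (fun c => c.1.2) eq_code.
  move: eq_p rot_j {eq_code uT'}; rewrite -{}eq_u /= => eq_p rot_j.
  have ltM (i : 'I_n.-1) : i < size (others (Y u)) by rewrite size_mkseq.
  (* The vertex just ahead of [u] identifies the gap, the other vertices being distinct. *)
  have {rot_j} jj : j = j'.
    apply/val_inj/eqP; rewrite -(nth_uniq u (ltM j) (ltM j') (others_uniq _)).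
    have := congr1 (nth u ^~ 0) rot_j; rewrite /rot.
    by rewrite (drop_nth u (ltM j)) (drop_nth u (ltM j')) /= => ->.
  (* With equal gaps the partial sweeps have the same shift, and only the drifts remain to be
     compared. *)
  move: eq_p; rewrite -jj => /addrI/oppr_inj/(drift_inj (ltn_ord t) (ltn_ord t')) tt.
  by congr (_, (_, _)); apply: val_inj.
have -> : N = #|f @: D|.
  rewrite (card_in_imset f_inj) cardsX cardsT card_prod !card_ord; lia.
apply: subset_leq_card; apply/subsetP => _ /imsetP[[u [j t]] /setXP[/= uT _] ->].
rewrite inE -fconnect_orbit; have /and3P[xY _ _] := YP u uT.
exact: connect_trans xY (fconnect_iter _ _ _).
Qed.

Lemma card_Theta_orbit : #|Theta_orbit Erefl Erefr x| = N.
Proof. by apply/eqP; rewrite eqn_leq Theta_orbit_le Theta_orbit_ge. Qed.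

End OrbitSize.

(** * Signs *)

Lemma card_set2I (T : finType) (u v : T) (X : {set T}) : u != v ->
  #|[set u; v] :&: X| = (u \in X) + (v \in X).
Proof.
move=> uv; rewrite (cardsD1 u) (cardsD1 v) !inE !eqxx orbT /= (eq_sym v) uv /=.
rewrite (_ : _ :\ v = set0) ?cards0 ?addn0 //.
by apply/setP => y; rewrite !inE; case: eqP => //; case: eqP.
Qed.

Section Signs.
Variables (V : finType) (Erefl Erefr : {set {set V}}).
Local Notation E := (Erefl :|: Erefr).
Hypothesis EE : [disjoint Erefl & Erefr].
Hypothesis fE : forest E.
Implicit Types (d : V -> bool) (X : {set V} * {set V}).

Lemma sign_partition_in VT X y : sign_partition Erefl Erefr VT X ->
  y \in VT -> (y \in X.1) = (y \notin X.2).
Proof.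
case/and4P=> /eqP <- X12 _ _; rewrite inE.
case y1: (y \in X.1) => /=; first by rewrite (disjointFr X12 y1).
by move=> ->.
Qed.

(** With [X.2] as the part of sign -1, membership in it is a colouring of the kind the walk
    requires. *)
Lemma sign_partition_edge VT X u v : sign_partition Erefl Erefr VT X ->
  [set u; v] \in E -> [set u; v] \subset VT ->
  (u \in X.2) (+) (v \in X.2) = ([set u; v] \notin Erefl).
Proof.
move=> sX uvE uvT; have uv : u != v by apply: adj_neq fE uvE.
have /subsetP uvT' := uvT.
have uT := uvT' u (set21 u v); have vT := uvT' v (set22 u v).
have uX := sign_partition_in sX uT; have vX := sign_partition_in sX vT.
case/and4P: sX => _ _ /forallP/(_ [set u; v])/implyP refr.
move=> /forallP/(_ [set u; v])/implyP refl.
have [uvl | uvl] := boolP ([set u; v] \in Erefl).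
  have := refl uvl; rewrite uvT /= !subUset !sub1set uX vX.
  by case: (u \in X.2) (v \in X.2) => [] [].
have uvr : [set u; v] \in Erefr by move: uvE; rewrite inE (negPf uvl).
have := refr uvr; rewrite uvT /= => /andP[_]; rewrite card_set2I //.
by case: (u \in X.2) (v \in X.2) => [] [].
Qed.

(** The parts are the colour classes in [VT] of a colouring that changes exactly across refraction
    edges. Hence the [pick] in [chi] succeeds. *)
Lemma sign_partition_exists VT :
  exists X, sign_partition Erefl Erefr VT X.
Proof.
have [d dE] := forest_bicoloring (fun A => A \notin Erefl) fE.
exists ([set y in VT | ~~ d y], [set y in VT | d y]).
apply/and4P; split=> /=.
- by apply/eqP/setP => y; rewrite !inE -andb_orr orNb andbT.
- by rewrite -setI_eq0; apply/eqP/setP => y; rewrite !inE; case: (d y); rewrite ?andbF.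
- apply/forall_inP => A Ar; apply/implyP => AT.
  have AE : A \in E by rewrite inE Ar orbT.
  have /cards2P[a [b [ab Aab]]] : #|A| == 2 by case: fE => s2 _; rewrite s2.
  have := dE a b; rewrite -Aab => /(_ AE); rewrite (disjointFl EE Ar) => dab.
  move: AT; rewrite Aab subUset !sub1set => /andP[aT bT].
  rewrite !card_set2I // !inE aT bT /=.
  by case: (d a) (d b) dab => [] [].
apply/forall_inP => A Al; apply/implyP => AT.
have AE : A \in E by rewrite inE Al.
have /cards2P[a [b [ab Aab]]] : #|A| == 2 by case: fE => s2 _; rewrite s2.
have := dE a b; rewrite -Aab => /(_ AE); rewrite Al => dab.
move: AT; rewrite Aab !subUset !sub1set !inE => /andP[-> ->] /=.
by case: (d a) (d b) dab => [] [].
Qed.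

(** On the component, [d] is read off the very partition picked by [chi], so its signs add up to the
    difference of the two cardinalities. Elsewhere any valid colouring fits, since no edge leaves
    the component. *)
Lemma chi_signing n v : exists2 d : V -> bool,
  forall x y, [set x; y] \in E -> d x (+) d y = ([set x; y] \notin Erefl) &
  exists b : bool, (\sum_(y in component E v) (-1) ^+ d y
     = (-1) ^+ b * (chi Erefl Erefr (component E v))%:R :> 'Z_n)%R.
Proof.
set T := component E v.
have [d0 d0E] := forest_bicoloring (fun A => A \notin Erefl) fE.
rewrite /chi; case: pickP => [X sX|noX]; last first.
  by have [X] := sign_partition_exists T; rewrite noX.
exists (fun y => if y \in T then y \in X.2 else d0 y).
  move=> x y xyE; have xy_T : (x \in T) = (y \in T).
    rewrite !inE; apply/idP/idP => /connect_trans; apply; apply: connect1 => //.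
    by rewrite adj_sym.
  rewrite xy_T; case: ifP => yT; last exact: d0E.
  by apply: sign_partition_edge sX _ _; rewrite // subUset !sub1set xy_T yT.
(* The sign lost in the absolute value of [chi]. *)
exists (#|X.1| < #|X.2|).
transitivity (#|X.1|%:R - #|X.2|%:R : 'Z_n)%R; last first.
  case: ltnP => X12.
    have -> : `|(#|X.1|%:Z - #|X.2|%:Z)%R| = #|X.2| - #|X.1| by lia.
    by rewrite natrB ?(ltnW X12) // expr1 mulN1r opprB.
  have -> : `|(#|X.1|%:Z - #|X.2|%:Z)%R| = #|X.1| - #|X.2| by lia.
  by rewrite natrB // mul1r.
have /and4P[/eqP XT X12 _ _] := sX.
rewrite (eq_bigl [predU X.1 & X.2]) => [|y]; last by rewrite -XT !inE.
rewrite bigU //= -!sum1_card !natr_sum -sumrN; congr (_ + _)%R.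
  apply: eq_bigr => y y1.
  by rewrite -XT inE y1 /= (disjointFr X12 y1).
by apply: eq_bigr => y y2; rewrite -XT inE y2 orbT.
Qed.

End Signs.

(** * Additive orders modulo n and the orbit formula *)

Lemma dvdn_mul_gcd n k t : 0 < n -> (n %| k * t) = (n %/ gcdn n k %| t).
Proof.
move=> n_gt0; have g_gt0 : 0 < gcdn n k by rewrite gcdn_gt0 n_gt0.
(* Divided by their gcd, [n] and [k] become coprime, so the factor [k %/ gcdn n k] can be
   inserted. *)
rewrite -(@Gauss_dvdr (n %/ gcdn n k) (k %/ gcdn n k)); last first.
  by rewrite /coprime -(eqn_pmul2r g_gt0) muln_gcdl !divnK ?dvdn_gcdl ?dvdn_gcdr ?mul1n.
by rewrite -[RHS](dvdn_pmul2r g_gt0) mulnAC !divnK ?dvdn_gcdl ?dvdn_gcdr.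
Qed.

Theorem theorem1p2 (n : nat) (V : finType) (E Erefl Erefr : {set {set V}})
    (hn : 3 <= n) (hV : #|V| = n) (hE : forest E)
    (hpart : edge_partition E Erefl Erefr)
    (s : labeling V n) (i : 'Z_n) (b : bool) :
  let x : Xi V n := (s, i, b) in
  let VT := component E (base_vertex x) in
  #|Theta_orbit Erefl Erefr x|
    = (#|VT| * n * n.-1) %/ gcdn n (chi Erefl Erefr VT).
Proof.
move=> x VT; have n_gt1 : 1 < n by apply: ltnW.
have n_gt0 : 0 < n by apply: ltnW.
case: hpart => EU EI; rewrite {}EU in hE VT *.
have [d0 d0E [b0 sum_d0]] := chi_signing EI hE n (base_vertex x).
set k := chi _ _ _ in sum_d0 *; set g := gcdn n k.
(* A global flip by [c] aligns the colouring with the given direction [b]; it preserves the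
   differences along edges and changes the drift at most by a sign. *)
pose c := b (+) d0 (base_vertex x); pose d y := c (+) d0 y.
have dE u v : [set u; v] \in Erefl :|: Erefr ->
    d u (+) d v = ([set u; v] \notin Erefl).
  by move=> /d0E <-; rewrite /d addbACA addbb.
have xd : aligned d x by rewrite /aligned /d /c addbK.
have driftE t : (drift n Erefl Erefr d (base_vertex x) *+ t == 0)%R = (n %/ g %| t).
  have -> : drift n Erefl Erefr d (base_vertex x) = ((-1) ^+ (c (+) b0) * k%:R)%R.
    rewrite signr_addb -mulrA -sum_d0 mulr_sumr.
    by apply: eq_bigr => y _; rewrite signr_addb.
  rewrite -(dvdn_mul_gcd k t n_gt0) -mulrnAr -mulrnA.
  have -> : ((-1) ^+ (c (+) b0) * (k * t)%:R == 0 :> 'Z_n)%R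
            = ((k * t)%:R == 0 :> 'Z_n)%R.
    by case: (c (+) b0); rewrite ?mulN1r ?oppr_eq0 ?mul1r.
  by rewrite -val_eqE /= val_Zp_nat.
rewrite (card_Theta_orbit n_gt1 hV hE dE _ driftE xd); last first.
  by rewrite divn_gt0 ?gcdn_gt0 ?n_gt0 // dvdn_leq ?dvdn_gcdl.
rewrite -/VT [in RHS]mulnAC -muln_divA ?dvdn_gcdl //.
by rewrite mulnC (mulnC n.-1).
Qed.
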